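(* Let $B_n$ be the set of ballot sequences in $\Pi(1^n2^n)$ and let $R_n$ be the set of integer partitions $\lambda$ whose Ferrers diagram fits in an $n\times n$ square and which satisfy $r_i(\lambda)<0$ for all $1\le i\le d(\lambda)$. Then $$\phi(B_n)=\{w\in\Pi(1^n2^n) : \lambda(w)\in R_n\},$$ where $\phi$ is Foata's fundamental bijection.
   Context: $\mathbb P^*$ is the set of all finite words in the positive integers. For a word $w$, $\Pi(w)$ is the set of all rearrangements of $w$; $1^n2^n$ is the word with $n$ ones followed by $n$ twos. A word $w\in\{1,2\}^*$ is a ballot sequence if every prefix of $w$ contains at least as many ones as twos. Foata's fundamental bijection $\phi:\mathbb P^*\to\mathbb P^*$: $\phi(\epsilon)=\epsilon$ for the empty word $\epsilon$. For $v=a_1\ldots a_n$ with $n\ge1$, define $w_1=a_1$ and, given $w_i=b_1\ldots b_i$, define $w_{i+1}$ as follows. If $b_i\le a_{i+1}$ (respectively $b_i>a_{i+1}$), factor $w_i=f_1f_2\cdots f_k$ uniquely so that in each factor every letter is $>a_{i+1}$ (respectively $\le a_{i+1}$) except its last letter, which is $\le a_{i+1}$ (respectively $>a_{i+1}$). Let $g_j$ be obtained from $f_j$ by moving its last letter to the front, and set $w_{i+1}=g_1g_2\cdots g_k\,a_{i+1}$. Then $\phi(v)=w_n$. The map $\phi$ is a bijection preserving the multiset of letters. Partition of a word: for $w\in\{1,2\}^*$ with $m$ ones and $n$ twos, view $w$ as a lattice path from $(0,0)$ to $(n,m)$, a $1$ being a unit north step and a $2$ a unit east step. $\lambda(w)$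 is the integer partition whose Ferrers diagram consists of the boxes of the $m\times n$ rectangle ($m$ rows, $n$ columns) lying northwest of this path. Equivalently, $\lambda_i$ is the number of twos preceding the $i$th one of $w$ counted from the right (zero parts are discarded). For a partition $\lambda$ with conjugate $\lambda'$, $d(\lambda)$ is the side length of its Durfee square (the largest $d\times d$ square contained in its Ferrers diagram), and the $i$th rank is $r_i(\lambda)=\lambda_i-\lambda_i'$ for $1\le i\le d(\lambda)$. The empty partition satisfies the rank condition vacuously. *)

(* Defs.v *)
From mathcomp Require Import all_boot all_order all_algebra.
From mathcomp Require Import classical_sets.

Set Implicit Arguments.
Unset Strict Implicit.
Unset Printing Implicit Defensive.

Local Open Scope classical_set_scope.

(* Words have type [seq nat]; the letter 0 is allowed, but no rearrangement of
   1^n 2^n contains it. *)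
Definition rearrangements (u : seq nat) : set (seq nat) :=
  [set w | perm_eq w u].

Definition ones_twos (n : nat) : seq nat := nseq n 1 ++ nseq n 2.

Definition ballot (w : seq nat) : Prop :=
  forall u, prefix u w -> count_mem 2 u <= count_mem 1 u.

Definition B (n : nat) : set (seq nat) :=
  [set w | rearrangements (ones_twos n) w /\ ballot w].

(* Cuts [w] after each letter satisfying [p].  Any letters after the last such
   letter would form one more block; this never happens in [foata_step]. *)
Fixpoint factors (p : pred nat) (w : seq nat) : seq (seq nat) :=
  if w is b :: w' then
    if p b then [:: b] :: factors p w'
    else if factors p w' is f :: fs then (b :: f) :: fs else [:: [:: b]]
  else [::].

Definition is_factor (p : pred nat) (f : seq nat) : Prop :=
  exists u b, [/\ f = rcons u b, all (predC p) u & p b].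

Lemma flatten_factors (p : pred nat) (w : seq nat) : flatten (factors p w) = w.
Proof.
elim: w => //= b w IH; case: (p b) => /=; first by rewrite IH.
by case: (factors p w) IH => [|f fs] /= <-.
Qed.

Lemma factorsP (p : pred nat) (w : seq nat) (x0 : nat) : p (last x0 w) ->
  forall f, f \in factors p w -> is_factor p f.
Proof.
elim: w x0 => [|b w IH] x0 //= pl f; case: ifPn => [pb|npb].
  rewrite inE => /predU1P[->|/(IH _ pl)//].
  by exists [::], b.
have := flatten_factors p w; case E: (factors p w) => [|g gs] /= ew.
  by move: pl; rewrite -ew /= (negbTE npb).
rewrite inE => /predU1P[->|fgs]; last by apply: IH pl _ _; rewrite E inE fgs orbT.
have [|u [c [-> au pc]]] := IH _ pl g; first by rewrite E mem_head.
by exists (b :: u), c; split; rewrite //= npb.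
Qed.

Lemma factors_unique (p : pred nat) (w : seq nat) (fs : seq (seq nat)) :
  flatten fs = w -> (forall f, f \in fs -> is_factor p f) -> factors p w = fs.
Proof.
move=> <-; elim: fs => //= f fs IH H.
have [u [b [-> au pb]]] := H _ (mem_head _ _).
have {}IH : factors p (flatten fs) = fs.
  by apply: IH => g gfs; apply: H; rewrite inE gfs orbT.
elim: u au => [_|c u IHu /= /andP[npc /IHu ->]] /=; first by rewrite pb IH.
by rewrite (negbTE npc).
Qed.

Definition foata_step (w : seq nat) (a : nat) : seq nat :=
  let p := if last 0 w <= a then fun b => b <= a else fun b => a < b in
  rcons (flatten [seq rotr 1 f | f <- factors p w]) a.

(* The recursion starts from w_0 = [::], for which [foata_step] gives
   w_1 = [:: a_1]. *)
Definition phi (v : seq nat) : seq nat := foldl foata_step [::] v.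

(* Partitions are weakly decreasing sequences of positive parts, indexed
   from 0. *)
Definition is_part (s : seq nat) : bool := sorted geq s && (0 \notin s).

(* The numbers of twos before the ones of [w], the ones being read from right
   to left, with zeros discarded. *)
Definition lambda (w : seq nat) : seq nat :=
  [seq k <- rev [seq count_mem 2 (take i w) | i <- iota 0 (size w)
                                            & nth 0 w i == 1] | 0 < k].

Definition in_ferrers (s : seq nat) (i j : nat) : bool := j < nth 0 s i.

Definition conj_part (s : seq nat) : seq nat :=
  mkseq (fun j => count (fun x => j < x) s) (head 0 s).

Definition durfee (s : seq nat) : nat :=
  \max_(d < (size s).+1 | [forall i : 'I_d, forall j : 'I_d, in_ferrers s i j])
    d.

(* [rank s i] is the rank r_(i+1) of [s]. *)
Definition rank (s : seq nat) (i : nat) : int :=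
  ((nth 0 s i)%:Z - (nth 0 (conj_part s) i)%:Z)%R.

Definition R (n : nat) : set (seq nat) :=
  [set s | [/\ is_part s,
               forall i j, in_ferrers s i j -> i < n /\ j < n
             & forall i, i < durfee s -> (rank s i < 0)%R]].

(* Main.v *)
Require Import Defs.
From mathcomp Require Import all_boot all_order all_algebra.
From mathcomp Require Import classical_sets.
From mathcomp Require Import zify.

Local Open Scope classical_set_scope.

(** On words in 1 and 2 the map phi is governed by two rules: a new 2 is simply
    appended, and before a new 1 is appended the last letter of the word built
    so far is moved to the front ([foata_step2], [foata_step1]).  Hence phi is a
    bijection on such words, and what happens to a descent, that is to a 2
    followed at once by a 1, can be traced.

    Write v = x 2 1 y.  When the displayed 1 is read, the displayed 2 jumps in
    front of phi(x), giving 2 phi(x) 1.  Each later 1 puts the preceding letter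
    on the far left; if that letter is a 1, the new 1 replaces it on the right,
    and if it is a 2, there is one more 2 on the left and one more 1 on the
    right, which happens once per descent.  So phi(v) = A 2 phi(x) 1 C, where
    the numbers of twos in A and of ones in C both equal the number i of
    descents of 1 y ([phi_cat1]).  As phi(x) is a rearrangement of x, the
    displayed 1 and 2 give the part and the conjugate part of lambda(phi(v)) of
    index i, counted from 0: they are i + 1 + #2(x) and i + 1 + #1(x).  The
    rank at i is therefore #2(x) - #1(x), and it is negative exactly when the
    prefix x 2 of v has at least as many ones as twos ([rank_descent]).

    It remains to see that these inequalities, one for each descent, are both
    all the ranks and the whole ballot condition.  A descent always falls inside
    the Durfee square, and if v begins with 1 the square is no larger than the
    number of descents ([durfee_phi1]).  On the ballot side, a prefix with an
    excess of twos can be shortened or lengthened to one that ends in the 2 of a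
    descent, provided v has as many ones as twos ([ballot_of_descents]). *)

(** * Foata's bijection on words in two letters *)

Definition binary (w : seq nat) : bool := all (fun b => (b == 1) || (b == 2)) w.

Lemma binary_rcons w a :
  binary (rcons w a) = ((a == 1) || (a == 2)) && binary w.
Proof. exact: all_rcons. Qed.

Lemma perm_binary u v : perm_eq u v -> binary u = binary v.
Proof. exact: perm_all. Qed.

(** If only the letter c can end a factor, then moving each factor's last letter
    to its front amounts to rotating the whole word: every c moves to where the
    previous factor ended, and the last one goes to the front. *)
Lemma flatten_rotr_factors (p : pred nat) c u :
  p c -> {in u, forall b, p b -> b = c} ->
  flatten [seq rotr 1 f | f <- factors p (rcons u c)] = c :: u.
Proof.
move=> pc; elim: u => [_|b u IH Hu] /=; first by rewrite pc.
have {}IH := IH (fun x xu => Hu x (mem_behead (s := b :: u) xu)).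
case: ifPn => [pb|npb] /=; first by rewrite IH (Hu b (mem_head _ _) pb).
have pl : p (last 0 (rcons u c)) by rewrite last_rcons.
have := @factorsP p (rcons u c) 0 pl; move: IH.
case: (factors p (rcons u c)) => [|f fs] //= IH /(_ f (mem_head _ _)).
case=> g [c' [Ef _ _]]; move: IH; rewrite {}Ef.
by rewrite -rcons_cons !rotr1_rcons /= => -[-> ->].
Qed.

(** All letters are at most 2, so every factor is a single letter. *)
Lemma foata_step2 w : binary w -> foata_step w 2 = rcons w 2.
Proof.
move=> bw; rewrite /foata_step; congr rcons.
have all2 : all (leq^~ 2) w.
  by apply: sub_all bw => b /orP[]/eqP->.
have -> : last 0 w <= 2.
  have /allP : all (leq^~ 2) (0 :: w) by [].
  by apply; exact: mem_last.
by elim: w all2 {bw} => //= b w IH /andP[-> /IH] /= ->.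
Qed.

(** Factors end in 1 or end in 2 according to the last letter of w, so
    [flatten_rotr_factors] applies in either case. *)
Lemma foata_step1 w : binary w -> foata_step w 1 = rcons (rotr 1 w) 1.
Proof.
case/lastP: w => [|u c] // bw; rewrite /foata_step last_rcons; congr rcons.
move: bw; rewrite binary_rcons rotr1_rcons => /andP[c12 /allP bu].
case/orP: c12 => /eqP-> /=; apply: flatten_rotr_factors => // b /bu.
  by case/orP => /eqP->.
by case/orP => /eqP->.
Qed.

Lemma phi_rcons v a : phi (rcons v a) = foata_step (phi v) a.
Proof. by rewrite /phi foldl_rcons. Qed.

Lemma last_phi v : last 0 (phi v) = last 0 v.
Proof.
by case/lastP: v => // v a; rewrite phi_rcons /foata_step !last_rcons.
Qed.

Lemma perm_phi v : binary v -> perm_eq (phi v) v.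
Proof.
elim/last_ind: v => // v a IH.
rewrite binary_rcons => /andP[a12 /[dup] bv /IH pv].
have bpv : binary (phi v) by rewrite (perm_binary _ _ pv).
have prc u : perm_eq u v -> perm_eq (rcons u a) (rcons v a).
  by rewrite !(perm_rcons, perm_sym _ (rcons _ _)) perm_cons perm_sym.
rewrite phi_rcons; case/orP: a12 prc => /eqP-> prc.
  by rewrite foata_step1 // prc // perm_rotr.
by rewrite foata_step2 // prc.
Qed.

Lemma binary_phi v : binary v -> binary (phi v).
Proof. by move=> bv; rewrite (perm_binary _ _ (perm_phi v bv)). Qed.

Lemma phi_rcons2 v : binary v -> phi (rcons v 2) = rcons (phi v) 2.
Proof. by move=> bv; rewrite phi_rcons foata_step2 ?binary_phi. Qed.

Lemma phi_rcons1 v : binary v -> phi (rcons v 1) = rcons (rotr 1 (phi v)) 1.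
Proof. by move=> bv; rewrite phi_rcons foata_step1 ?binary_phi. Qed.

(** The last letter of phi(v) is that of v, so it says which of the two rules
    was applied last; both rules are invertible. *)
Lemma phi_surj w : binary w -> exists2 v, binary v & phi v = w.
Proof.
elim: {w}(size w) {-2}w (erefl (size w)) => [|m IH] w.
  by move/size0nil=> -> _; exists [::].
case/lastP: w => // u a; rewrite size_rcons binary_rcons => -[su] /andP[a12 bu].
case/orP: (a12) => /eqP Ea; rewrite {}Ea in a12 *.
  have bru : binary (rot 1 u) by rewrite (perm_binary _ u) // perm_rot.
  have [v bv Ev] := IH (rot 1 u) (etrans (size_rot 1 u) su) bru.
  by exists (rcons v 1); rewrite ?binary_rcons // phi_rcons1 // Ev rotK.
have [v bv Ev] := IH u su bu.
by exists (rcons v 2); rewrite ?binary_rcons // phi_rcons2 // Ev.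
Qed.

(** * Descents *)

Fixpoint descents (v : seq nat) : nat :=
  if v is b :: v' then ((b == 2) && (head 0 v' == 1)) + descents v' else 0.

(** The default 0 is harmless: a one-letter word has no descent. *)
Lemma descents_rcons v a :
  descents (rcons v a) = descents v + ((last 0 v == 2) && (a == 1)).
Proof.
elim: v => [|b v IH] //=; first by rewrite andbF.
by rewrite IH; case: v {IH} => [|c v] /=; rewrite ?andbF ?addn0 ?addnA.
Qed.

(** Counted from 0 and from the right, the i-th descent has i descents after
    it. *)
Lemma descent_split v i : i < descents v ->
  exists x y, v = x ++ [:: 2, 1 & y] /\ descents (1 :: y) = i.
Proof.
elim: v => // b v IH /=.
have [/IH [x [y [-> <-]]] _|le_i lt_i] := ltnP i (descents v).
  by exists (b :: x), y.
case: andP lt_i => [[/eqP-> hv] lt_i|_]; last by rewrite ltnNge le_i.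
case: v hv le_i lt_i {IH} => [|c v] //= /eqP-> le_i lt_i.
exists [::], v; split=> //=; lia.
Qed.

(** The word between A and the displayed 1 is never touched again: a later 1
    moves a letter from the right end to the left end.  If that letter is a 2,
    a descent has just been completed, A gains a 2 and C trades a 2 for a 1; if
    it is a 1, neither count changes. *)
Lemma phi_cat1 x y : binary x -> binary y ->
  exists A C, [/\ phi (x ++ 1 :: y) = A ++ rotr 1 (phi x) ++ 1 :: C,
    count_mem 2 A = descents (1 :: y) & count_mem 1 C = descents (1 :: y)].
Proof.
move=> bx; elim/last_ind: y => [_|y a IH].
  by exists [::], [::]; rewrite cats1 phi_rcons1 //= cats1.
rewrite binary_rcons => /andP[a12 by_].
have [A [C [E cA cC]]] := IH by_.
have bv : binary (x ++ 1 :: y) by rewrite /binary all_cat /=; apply/andP.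
rewrite -rcons_cons -rcons_cat descents_rcons.
case/orP: a12 => /eqP->; last first.
  exists A, (rcons C 2); rewrite phi_rcons2 // E -cats1 -!catA /= cats1.
  by rewrite andbF addn0 -cats1 count_cat /= !addn0.
have El : last 0 (1 :: y) = last 0 (1 :: C).
  by have := last_phi (x ++ 1 :: y); rewrite E catA !last_cat /= => ->.
rewrite phi_rcons1 // E El andbT.
case/lastP: C E cC El => [|C l] E cC El /=.
  (* The last letter is the displayed 1 itself; it moves to the left and the new
     1 takes its place. *)
  exists (1 :: A), [::]; rewrite catA cats1 rotr1_rcons /= -cats1 -catA /=.
  by rewrite addn0 in cA *.
have : binary (phi (x ++ 1 :: y)) by exact: binary_phi.
rewrite E catA /binary all_cat /= all_rcons last_rcons => /and3P[_ l12 _].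
exists (l :: A), (rcons C 1).
rewrite -rcons_cons -rcons_cat rotr1_rcons /= cA.
rewrite -!cats1 !count_cat /= !addn0 in cC *.
split; first by rewrite -!catA.
  by rewrite addnC.
by case/orP: l12 cC => /eqP-> /= <-; rewrite ?addn0.
Qed.

(** * The partition of a word *)

(** The parts of lambda(w), zeros included, in increasing order; unlike
    [lambda] this list behaves well under concatenation. *)
Definition twos_before (w : seq nat) : seq nat :=
  [seq count_mem 2 (take i w) | i <- iota 0 (size w) & nth 0 w i == 1].

Lemma twos_before_cons b w : twos_before (b :: w) =
  nseq (b == 1) 0 ++ [seq (b == 2) + k | k <- twos_before w].
Proof.
rewrite /twos_before /= (iotaDl 1 0) filter_map.
by case: (b == 1); rewrite /= -!map_comp.
Qed.

Lemma twos_before_cat u v : twos_before (u ++ v) =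
  twos_before u ++ [seq count_mem 2 u + k | k <- twos_before v].
Proof.
elim: u => [|b u IH] /=; first by rewrite map_id.
rewrite !twos_before_cons IH map_cat -catA; congr (_ ++ (_ ++ _)).
by rewrite -map_comp; apply: eq_map => k /=; rewrite addnA.
Qed.

Lemma size_twos_before w : size (twos_before w) = count_mem 1 w.
Proof.
elim: w => // b w IH.
by rewrite twos_before_cons size_cat size_nseq size_map IH.
Qed.

Lemma twos_before_le w : all (leq^~ (count_mem 2 w)) (twos_before w).
Proof.
apply/allP => k /mapP[i _ ->] /=.
by rewrite -[w in leqRHS](cat_take_drop i) count_cat leq_addr.
Qed.

Lemma sorted_twos_before w : sorted leq (twos_before w).
Proof.
elim: w => // b w IH; rewrite twos_before_cons.
have H : sorted leq [seq (b == 2) + k | k <- twos_before w].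
  by rewrite sorted_map; apply: sub_sorted IH => i j /=; rewrite leq_add2l.
case: (b == 1) => //=; rewrite path_min_sorted //.
by apply/allP.
Qed.

Lemma geq_trans : transitive geq.
Proof. by move=> x y z le_xy le_zx; exact: leq_trans le_zx le_xy. Qed.

Lemma nth_filter_pos s i : sorted geq s ->
  nth 0 [seq k <- s | 0 < k] i = nth 0 s i.
Proof.
elim: s i => //= a s IH i pas; case: a pas => [|a] pas /=; last first.
  by case: i => //= i; rewrite IH // (path_sorted pas).
have {pas} s0 : all (geq 0) s.
  exact: order_path_min geq_trans pas.
rewrite (_ : [seq k <- s | 0 < k] = [::]) ?nth_nil; last first.
  apply/eqP; rewrite -(negbK (_ == _)) -has_filter -all_predC.
  by apply: sub_all s0 => -[].
case: i => //= i; have [lt_i|le_i] := ltnP i (size s).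
  by move/all_nthP: s0 => /(_ 0 _ lt_i) /=; case: nth.
by rewrite nth_default.
Qed.

Lemma lambdaE w : lambda w = [seq k <- rev (twos_before w) | 0 < k].
Proof. by []. Qed.

Lemma sorted_rev_twos_before w : sorted geq (rev (twos_before w)).
Proof. by rewrite rev_sorted; exact: sorted_twos_before. Qed.

Lemma is_part_lambda w : is_part (lambda w).
Proof.
rewrite /is_part lambdaE mem_filter /= andbT.
exact: (sorted_filter geq_trans) (sorted_rev_twos_before w).
Qed.

(** Read from the right, the displayed 1 comes after the ones of v. *)
Lemma nth_lambda u v :
  nth 0 (lambda (u ++ 1 :: v)) (count_mem 1 v) = count_mem 2 u.
Proof.
rewrite lambdaE nth_filter_pos ?sorted_rev_twos_before //.
rewrite twos_before_cat twos_before_cons /= rev_cat rev_cons nth_cat.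
rewrite size_rcons size_rev 2!size_map size_twos_before ltnSn.
by rewrite nth_rcons size_rev 2!size_map size_twos_before ltnn eqxx addn0.
Qed.

(** Beyond the first part [conj_part] takes the default value 0, and the count
    vanishes there too because the first part is the largest. *)
Lemma nth_conj_part s j : is_part s ->
  nth 0 (conj_part s) j = count (fun x => j < x) s.
Proof.
move=> /andP[ss _]; have [lt_j|le_j] := ltnP j (head 0 s).
  by rewrite nth_mkseq.
rewrite nth_default ?size_mkseq //; apply/esym/eqP.
rewrite -leqn0 leqNgt -has_count -all_predC.
case: s ss le_j => //= a s pas le_j; rewrite -leqNgt le_j /=.
apply: sub_all (order_path_min geq_trans pas) => x /=.
by rewrite -leqNgt => /leq_trans; apply.
Qed.

(** The parts exceeding the number of twos of u come from the ones after the
    displayed 2. *)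
Lemma nth_conj_lambda u v :
  nth 0 (conj_part (lambda (u ++ 2 :: v))) (count_mem 2 u) = count_mem 1 v.
Proof.
rewrite nth_conj_part ?is_part_lambda // lambdaE count_filter.
rewrite (eq_count (a2 := fun x => count_mem 2 u < x)); last by move=> x /=; lia.
rewrite count_rev twos_before_cat twos_before_cons /= count_cat -map_comp.
rewrite -size_twos_before -[in RHS](size_map (addn (count_mem 2 u) \o addn 1)).
rewrite -[RHS]add0n; congr (_ + _).
  apply/eqP; rewrite -leqn0 leqNgt -has_count -all_predC.
  by apply: sub_all (twos_before_le u) => x /=; rewrite -leqNgt.
by apply/eqP; rewrite -all_count all_map; apply/allP => x _ /=; lia.
Qed.

Lemma nth_part_le s i j : is_part s -> i <= j -> nth 0 s j <= nth 0 s i.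
Proof.
move=> /andP[ss _] le_ij; have [lt_j|le_j] := ltnP j (size s); last first.
  by rewrite nth_default.
apply: (sorted_leq_nth geq_trans leqnn 0 ss) => //; rewrite inE //.
exact: leq_ltn_trans lt_j.
Qed.

(** Since parts decrease, the square of side i + 1 fits as soon as its corner
    does. *)
Lemma durfee_gt s i : is_part s -> (i < durfee s) = (i < nth 0 s i).
Proof.
move=> ps; apply/idP/idP => [|lt_i].
  rewrite /durfee; apply: contraTT; rewrite -!leqNgt => le_i.
  apply/bigmax_leqP => d /forallP Hd; rewrite leqNgt; apply/negP => lt_d.
  have /forallP/(_ (Ordinal lt_d)) := Hd (Ordinal lt_d).
  by rewrite /in_ferrers /= ltnNge le_i.
have lt_is : i.+1 < (size s).+1.
  by rewrite ltnS ltnNge; apply/negP => /(nth_default 0) E; rewrite E in lt_i.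
rewrite /durfee; apply: (bigmax_sup (Ordinal lt_is)) => //.
apply/forallP => a; apply/forallP => b; rewrite /in_ferrers.
have lea : a <= i by rewrite -ltnS.
have leb : b <= i by rewrite -ltnS.
have := nth_part_le s a i ps lea; lia.
Qed.

Lemma lambda_bounds w i j : in_ferrers (lambda w) i j ->
  i < count_mem 1 w /\ j < count_mem 2 w.
Proof.
rewrite /in_ferrers lambdaE nth_filter_pos ?sorted_rev_twos_before // => lt_j.
have lt_i : i < size (rev (twos_before w)).
  by rewrite ltnNge; apply/negP => /(nth_default 0) E; rewrite E in lt_j.
split; first by rewrite -size_twos_before -size_rev.
apply: leq_trans lt_j _.
have := twos_before_le w; rewrite -all_rev => /all_nthP; exact.
Qed.

(** * Ranks and descents *)

(** The case where the factor before the displayed 1 of [phi_cat1] is x 2, with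
    phi(x 2) = phi(x) 2 rotated into 2 phi(x). *)
Lemma rank_descent x y : binary x -> binary y ->
  let i := descents (1 :: y) in let s := lambda (phi (x ++ [:: 2, 1 & y])) in
  i < durfee s /\ (rank s i < 0)%R = (count_mem 2 x < count_mem 1 x).
Proof.
move=> bx by_ i s.
have bx2 : binary (rcons x 2) by rewrite binary_rcons.
have [A [C [E cA cC]]] := phi_cat1 (rcons x 2) y bx2 by_.
have /permP px := perm_phi x bx.
rewrite cat_rcons phi_rcons2 // rotr1_rcons /= in E.
rewrite -/i in cA cC; clearbody i.
have row : nth 0 s i = i.+1 + count_mem 2 x.
  rewrite /s E -cat_cons catA -[in LHS]cC nth_lambda count_cat /=.
  by rewrite cA px addnA addn1.
have col : nth 0 (conj_part s) i = i.+1 + count_mem 1 x.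
  by rewrite /s E -[in LHS]cA nth_conj_lambda count_cat /= cC px add1n addnC.
rewrite durfee_gt ?is_part_lambda // row.
split; first by lia.
rewrite /rank row col; lia.
Qed.

(** By [phi_cat1] with x empty, phi(1 y) = A 1 C, and the 1 gives a part of
    index e and value e, where e is the number of descents; so the box (e, e)
    is outside the diagram. *)
Lemma durfee_phi1 y : binary y ->
  durfee (lambda (phi (1 :: y))) <= descents (1 :: y).
Proof.
move=> by_; have [A [C [E cA cC]]] := phi_cat1 [::] y isT by_.
rewrite leqNgt durfee_gt ?is_part_lambda //.
by rewrite -[X in nth _ _ X]cC -leqNgt (E : phi (1 :: y) = _) /= nth_lambda cA.
Qed.

(** Take a prefix with more twos than ones.  Dropping trailing ones keeps the
    excess, so it may be assumed to end in 2; appending twos keeps it as well,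
    and a 1 must follow eventually because v is balanced.  This yields a descent
    that violates the hypothesis. *)
Lemma ballot_of_descents v : binary v -> count_mem 1 v = count_mem 2 v ->
  (forall x y, v = x ++ [:: 2, 1 & y] -> count_mem 2 x < count_mem 1 x) ->
  ballot v.
Proof.
move=> bv eqv Hd.
have prefix_end2 t u : v = u ++ 2 :: t -> count_mem 2 u < count_mem 1 u.
  elim: t u => [|b t IH] u Ev.
    by move: eqv; rewrite Ev !count_cat /=; lia.
  have : b \in v by rewrite Ev mem_cat !inE eqxx !orbT.
  move/(allP bv)/orP => [] /eqP Eb; rewrite Eb in Ev; first exact: Hd Ev.
  have := IH (rcons u 2); rewrite cat_rcons => /(_ Ev).
  by rewrite -cats1 !count_cat /=; lia.
move=> u /prefixP[t]; elim/last_ind: u t => [//|u b IH] t Ev.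
have : b \in v by rewrite Ev mem_cat mem_rcons mem_head.
rewrite cat_rcons in Ev; move/(allP bv)/orP => [] /eqP Eb; rewrite Eb in Ev *.
  by have := IH _ Ev; rewrite -cats1 !count_cat /=; lia.
by have := prefix_end2 _ _ Ev; rewrite -cats1 !count_cat /=; lia.
Qed.

Lemma rearrangement_ones_twos n w : rearrangements (ones_twos n) w ->
  [/\ binary w, count_mem 1 w = n & count_mem 2 w = n].
Proof.
rewrite /rearrangements /= => pw; rewrite (perm_binary _ _ pw) !(permP pw).
rewrite /binary /ones_twos all_cat !all_nseq !count_cat !count_nseq /=.
by split; rewrite ?orbT; lia.
Qed.

Theorem theorem3p1 (n : nat) :
  phi @` B n = [set w | rearrangements (ones_twos n) w /\ R n (lambda w)].
Proof.
apply/seteqP; split=> [_ [v [Pv ballot_v] <-]|w [Pw [_ _ neg_w]]] /=.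
- have [bv v1 v2] := rearrangement_ones_twos _ _ Pv.
  have pv := perm_phi v bv.
  split; first exact: perm_trans pv Pv.
  split; first exact: is_part_lambda.
    by move=> i j /lambda_bounds; rewrite !(permP pv) v1 v2.
  move=> i lt_i.
  have lt_id : i < descents v.
    apply: leq_trans lt_i _; case: v bv ballot_v {Pv v1 v2 pv} => [|b y].
      by rewrite leqNgt durfee_gt ?is_part_lambda.
    move=> /= /andP[/orP[] /eqP-> by_] ballot_v; first exact: durfee_phi1.
    (* A ballot word cannot begin with 2. *)
    by have := ballot_v [:: 2]; rewrite (prefix_prefix [:: 2]) => /(_ isT).
  have [x [y [Ev <-]]] := descent_split v i lt_id.
  move: bv; rewrite Ev /binary all_cat /= => /andP[bx by_].
  have [_ ->] := rank_descent x y bx by_.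
  have := ballot_v (rcons x 2); rewrite Ev -cat_rcons prefix_prefix => /(_ isT).
  by rewrite -cats1 !count_cat /=; lia.
- have [bw w1 w2] := rearrangement_ones_twos _ _ Pw.
  have [v bv Ew] := phi_surj w bw.
  have pv := perm_phi v bv; rewrite Ew in pv.
  exists v => //; split; first by rewrite /rearrangements /= -(permPl pv).
  apply: ballot_of_descents => //; first by rewrite -!(permP pv) w1 w2.
  move=> x y Ev; move: (bv); rewrite Ev /binary all_cat /= => /andP[bx by_].
  have [lt_i <-] := rank_descent x y bx by_.
  by rewrite -Ev Ew in lt_i *; exact: neg_w.
Qed.
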